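(* Let $X$ be a countably infinite set, let $f:X\to X$ be a map satisfying the bounded condition, with $X_1,\dots,X_k$ ($k\ge 1$) pairwise disjoint subsets of $X$ such that $\bigcup_{i=1}^kX_i=X$ and each $f|_{X_i}$ is injective. Let $\mathcal{H}$ be a complex Hilbert space with orthonormal basis $\{e_x\}_{x\in X}$, and for $1\le i\le k$ let $T_i\in\mathcal{B}(\mathcal{H})$ be the partial isometry determined by $T_ie_x=e_{f(x)}$ if $x\in X_i$ and $T_ie_x=0$ if $x\notin X_i$. Let $x\in X$ and assume that $f$ satisfies the separating condition for $x$. If $y\sim z$ for every $y,z\in X$, then $C^{*}(T_1,T_2,\dots,T_k)$ has no non-trivial reducing subspaces.
   Context: $f$ satisfies the bounded condition if such finitely many pairwise disjoint sets $X_1,\dots,X_k$ exist; they are fixed. The orbit of $x$ is $\operatorname{orb}(x;f)=\{f^n(x)\mid n\ge 0\}$, with $f^0=\mathrm{id}_X$, and $\sim$ is the orbit equivalence relation by $f$: $x\sim y$ iff $\operatorname{orb}(x;f)\cap\operatorname{orb}(y;f)\neq\emptyset$. An $n$-tuple $(i_1,\dots,i_n)$ is aperiodic if $(i_{\sigma^j(1)},\dots,i_{\sigma^j(n)})\neq(i_1,\dots,i_n)$ for every $1\le j<n$, where $\sigma$ is the cyclic permutation $1\mapsto2\mapsto\cdots\mapsto n\mapsto1$. The map $f$ satisfies the separating condition for $x\in X$ (with respect to $X_1,\dots,X_k$) if: (i) there exists $n\ge1$ with $f^n(x)=x$; (ii) for the minimum such $n$, the $n$-tuple $(i_1,\dots,i_n)\in\{1,\dots,k\}^n$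 determined by $f^{j-1}(x)\in X_{i_j}$ for $1\le j\le n$ is aperiodic. $\mathcal{B}(\mathcal{H})$ is the algebra of bounded linear operators on $\mathcal{H}$. A $C^*$-algebra in $\mathcal{B}(\mathcal{H})$ is a norm-closed linear subspace closed under products and adjoints; $C^*(T_1,\dots,T_k)$ is the $C^*$-algebra generated by $T_1,\dots,T_k$, i.e. the smallest one containing them. A reducing subspace of a $C^*$-algebra $\mathcal{A}\subseteq\mathcal{B}(\mathcal{H})$ is a closed subspace $\mathcal{M}\subseteq\mathcal{H}$ with $S\mathcal{M}\subseteq\mathcal{M}$ and $S^*\mathcal{M}\subseteq\mathcal{M}$ for all $S\in\mathcal{A}$; the trivial ones are $\{0\}$ and $\mathcal{H}$. *)

(* Defs.v *)
From mathcomp Require Import all_boot all_order all_algebra.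
From mathcomp Require Import all_classical all_reals all_analysis.
From mathcomp Require Import complex.

Set Implicit Arguments.
Unset Strict Implicit.
Unset Printing Implicit Defensive.

Import numFieldNormedType.Exports.

Local Open Scope classical_set_scope.
Local Open Scope ring_scope.

Section Dynamics.
Context {X : Type}.
Implicit Types (f : X -> X) (x y : X).

Definition bounded_partition f (k : nat) (P : 'I_k -> set X) : Prop :=
  [/\ trivIset setT P, \bigcup_i P i = setT & forall i, set_inj (P i) f].

Definition orb f x : set X := range (fun n : nat => iter n f x).

Definition orbit_equiv f x y : Prop := orb f x `&` orb f y !=set0.

(* [rot j t] is the tuple (t_{s^j(1)}, ..., t_{s^j(n)}), with s the cyclic
   permutation 1 -> 2 -> ... -> n -> 1. *)
Definition aperiodic (A : eqType) (n : nat) (t : n.-tuple A) : Prop :=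
  forall j : nat, (1 <= j < n)%N -> rot j t <> t.

Definition min_period f x (n : nat) : Prop :=
  [/\ (1 <= n)%N, iter n f x = x &
      forall m : nat, (1 <= m)%N -> iter m f x = x -> (n <= m)%N].

(* When [P] is a partition of [X], there is exactly one tuple [t] as in the
   second clause. *)
Definition separating f (k : nat) (P : 'I_k -> set X) x : Prop :=
  (exists2 n : nat, (1 <= n)%N & iter n f x = x) /\
  forall (n : nat) (t : n.-tuple 'I_k), min_period f x n ->
    (forall j : 'I_n, P (tnth t j) (iter j f x)) -> aperiodic t.

End Dynamics.

Section Operators.
Context {R : realType} {H : completeNormedModType R[i]}.
Implicit Types (dot : {dot H for Num.conj}) (S : H -> H) (A G : set (H -> H)).

(* With this, the complete normed space [H] is a Hilbert space; [dot] is linear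
   in its first argument. *)
Definition induces_norm dot : Prop := forall u : H, `|u| ^+ 2 = dot u u.

Definition is_subspace (V : lmodType R[i]) (M : set V) : Prop :=
  M 0 /\ forall (a : R[i]) (u v : V), M u -> M v -> M (a *: u + v).

Definition lin_span (X : Type) (e : X -> H) : set H :=
  smallest (@is_subspace H) (range e).

Definition orthonormal_basis dot (X : Type) (e : X -> H) : Prop :=
  [/\ forall x, dot (e x) (e x) = 1,
      forall x y, x <> y -> dot (e x) (e y) = 0 &
      closure (lin_span e) = setT].

Definition bounded_op S : Prop :=
  linear S /\ exists c : R, forall u : H, `|S u| <= c%:C%C * `|u|.

Definition opnorm S : R :=
  inf [set c : R | 0 <= c /\ forall u : H, `|S u| <= c%:C%C * `|u|].

Definition is_adjoint dot S S' : Prop :=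
  forall u v : H, dot (S u) v = dot u (S' v).

Definition norm_closed A : Prop :=
  forall S, bounded_op S ->
    (forall eps : R, 0 < eps -> exists2 S', A S' & opnorm (S' - S) < eps) ->
    A S.

(* Every bounded operator on a Hilbert space has exactly one adjoint, so
   quantifying over all [S'] with [is_adjoint dot S S'] means taking [S' = S^*];
   likewise in [reducing]. *)
Definition is_Cstar_algebra dot A : Prop :=
  [/\ A `<=` bounded_op,
      is_subspace A,
      forall S S', A S -> A S' -> A (S \o S'),
      forall S S', A S -> is_adjoint dot S S' -> A S' &
      norm_closed A].

Definition Cstar dot G : set (H -> H) := smallest (is_Cstar_algebra dot) G.

Definition reducing dot A (M : set H) : Prop :=
  [/\ is_subspace M, closed M &
      forall S, A S -> S @` M `<=` M /\
        forall S', is_adjoint dot S S' -> S' @` M `<=` M].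

End Operators.

(* Main.v *)
Require Import Defs.
From HB Require Import structures.
From mathcomp Require Import all_boot all_order all_algebra.
From mathcomp Require Import all_classical all_reals all_analysis.
From mathcomp Require Import complex.
From mathcomp Require Import ring lra.
Import Order.TTheory GRing.Theory Num.Theory.
Import numFieldNormedType.Exports.
Local Open Scope classical_set_scope.
Local Open Scope ring_scope.
Set Implicit Arguments.
Unset Strict Implicit.
Unset Printing Implicit Defensive.

(* Let c be the itinerary of the periodic point x and W_m = T_(c (m-1)) ... T_(c 0).
   If y follows the itinerary of x forever, then y enters the cycle of x, by
   aperiodicity it does so in phase with x, and injectivity of f on each piece
   gives y = x.  So for y <> x the vectors W_m e_y vanish for large m, and as the
   T_i are contractions, W_(m n) u tends to <u, e_x> e_x, where n is a period of x.
   Hence a reducing subspace M contains e_x or is orthogonal to it.  As all orbits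
   meet, each e_y is obtained from e_x by applying operators T_i and T_i^*, so M
   contains all e_y or is orthogonal to all of them. *)

(* A discriminant bound, weakened from a to a + 1 so that a = 0 needs no case. *)
Lemma quadratic_ge_bound (R : realFieldType) (a k eps : R) : 0 <= a ->
  (forall t, - eps <= t ^+ 2 * a + t * k *+ 2) -> k ^+ 2 <= eps * (a + 1).
Proof.
move=> a0 /(_ (- (k / (a + 1)))).
set s := k / (a + 1).
have ks : k = s * (a + 1) by rewrite /s; field; lra.
by rewrite ks => h; nra.
Qed.

(** * Real inner product geometry, Riesz representation and adjoints *)

Section RealInnerProduct.
Context {R : realType} {H : completeNormedModType R[i]}.
Variables (dot : {dot H for Num.conj}) (dotN : induces_norm dot).
Implicit Types (u v w : H).

Definition rdot u v : R := complex.Re (dot u v).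

Lemma dotC u v : dot u v = (dot v u)^*.
Proof. by rewrite hermC /= expr0 mul1r. Qed.

Lemma dotDl u v w : dot (u + v) w = dot u w + dot v w.
Proof. exact: linearDl. Qed.

Lemma dotZl a u w : dot (a *: u) w = a * dot u w.
Proof. exact: linearZl_LR. Qed.

Lemma dotNl u w : dot (- u) w = - dot u w.
Proof. exact: linearNl. Qed.

Lemma dot0l w : dot 0 w = 0.
Proof. exact: linear0l. Qed.

Lemma dot0r w : dot w 0 = 0.
Proof. exact: linear0r. Qed.

Lemma dotBr u v w : dot u (v - w) = dot u v - dot u w.
Proof. exact: linearBr. Qed.

Lemma dotZr a u w : dot u (a *: w) = a^* * dot u w.
Proof. exact: linearZr_LR. Qed.

Lemma dot0P u v : dot u v = 0 -> dot v u = 0.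
Proof. by rewrite dotC => /eqP; rewrite conjC_eq0 => /eqP. Qed.

Lemma rdotC u v : rdot u v = rdot v u.
Proof. by rewrite /rdot dotC; case: (dot v u). Qed.

Lemma rdotDl u v w : rdot (u + v) w = rdot u w + rdot v w.
Proof. by rewrite /rdot dotDl raddfD. Qed.

Lemma rdotZl (t : R) u w : rdot (t%:C%C *: u) w = t * rdot u w.
Proof.
rewrite /rdot dotZl; case: (dot u w) => a b.
by rewrite /= mul0r subr0.
Qed.

Lemma rdotNl u w : rdot (- u) w = - rdot u w.
Proof. by rewrite /rdot dotNl raddfN. Qed.

Lemma rdotDr u v w : rdot u (v + w) = rdot u v + rdot u w.
Proof. by rewrite rdotC rdotDl !(rdotC u). Qed.

Lemma rdotZr (t : R) u w : rdot u (t%:C%C *: w) = t * rdot u w.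
Proof. by rewrite rdotC rdotZl rdotC. Qed.

Lemma rdotNr u w : rdot u (- w) = - rdot u w.
Proof. by rewrite rdotC rdotNl rdotC. Qed.

Definition rdotE := (rdotDl, rdotDr, rdotNl, rdotNr, rdotZl, rdotZr).

Lemma sqr_norm_rdot u : `|u| ^+ 2 = (rdot u u)%:C%C.
Proof.
have : 0 <= `|u| ^+ 2 by rewrite exprn_ge0.
rewrite dotN /rdot; case: (dot u u) => a b.
by rewrite lecE /= => /andP[/eqP -> _].
Qed.

Lemma rdot_ge0 u : 0 <= rdot u u.
Proof. by rewrite -lecR -sqr_norm_rdot exprn_ge0. Qed.

Lemma norm_ltE u (d : R) : 0 <= d -> (`|u| < d%:C%C) = (rdot u u < d ^+ 2).
Proof.
move=> d0; rewrite -ltcR -sqr_norm_rdot rmorphXn /= ltr_pXn2r ?nnegrE//.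
by rewrite lecR.
Qed.

(** Weakened Cauchy-Schwarz: [|u + t v|^2] is nonnegative for all real [t], and the discriminant
    bound contributes the [+ 1]. *)
Lemma sqr_rdot_le u v : rdot u v ^+ 2 <= rdot u u * (rdot v v + 1).
Proof.
apply: quadratic_ge_bound (rdot_ge0 v) _ => t.
have := rdot_ge0 (u + t%:C%C *: v).
by rewrite !rdotE (rdotC v u); nra.
Qed.

(* The representing vector minimizes J u = |u|^2 - 2 (l u); the parallelogram law
   makes the sublevel sets of J near its infimum a Cauchy filter. *)
Lemma real_riesz (l : H -> R) (C : R) : 0 <= C ->
  {morph l : u v / u + v} -> (forall (t : R) u, l (t%:C%C *: u) = t * l u) ->
  (forall u, l u ^+ 2 <= C * rdot u u) ->
  exists w, forall h, rdot h w = l h.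
Proof.
move=> C0 lD lZ lC.
pose J u := rdot u u - l u *+ 2.
have J_lb : has_lbound (range J).
  exists (- C) => _ [u _ <-]; rewrite /J.
  have := lC u; have := rdot_ge0 u; set q := rdot u u; set a := l u => q0 aq.
  suff : a *+ 2 <= q + C by lra.
  apply: contraT; rewrite -ltNge => h.
  suff : 0 < 0 :> R by rewrite ltxx.
  (* Contradicts AM-GM, since [(q + C)^2 >= 4 q C >= (2 a)^2]. *)
  have : 0 < (a *+ 2 - (q + C)) * (a *+ 2 + (q + C)) by apply: mulr_gt0; lra.
  have := sqr_ge0 (q - C); nra.
pose d := inf (range J).
have dJ u : d <= J u by apply: ge_inf => //; exists u.
pose A (eps : R) := [set u | J u < d + eps].
have A0 eps : 0 < eps -> exists u, A eps u.
  move=> e0; have [|_ [u _ <-] Ju] := inf_adherent (E := range J) e0.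
    by split=> //; exists (J 0), 0.
  by exists u.
pose F : set_system H := filter_from [set eps | 0 < eps] A.
have FF : ProperFilter F.
  apply: filter_from_proper; last by move=> i; exact: A0.
  apply: filter_from_filter; first by exists 1 => /=.
  move=> i j /= i0 j0; exists (Num.min i j); first by rewrite /= lt_min i0.
  by move=> u; rewrite /A /= => Ju; split; rewrite /A /=;
    apply: (lt_le_trans Ju); rewrite lerD2l ge_min lexx ?orbT.
have gap u v : rdot (u - v) (u - v) <= (J u + J v - d *+ 2) *+ 2.
  (* The infimum [d] also bounds [J] at the midpoint of [u] and [v]. *)
  have := dJ ((2^-1)%:C%C *: (u + v)).
  rewrite /J lZ lD !rdotE (rdotC v u); nra.
have Fcauchy : cauchy F.
  apply: cauchy_exP => eps eps0.
  (* Radii live in [R[i]]; a positive one has zero imaginary part. *)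
  have epsE : eps = (complex.Re eps)%:C%C.
    by move: eps0; rewrite ltcE; case: (eps) => a b /= /andP[/eqP -> _].
  move: eps0; rewrite epsE ltcR; set r := complex.Re eps => r0.
  (* Two excesses below [r^2 / 4], doubled by [gap], stay below [r^2]. *)
  have r0' : 0 < r ^+ 2 / 4 by rewrite divr_gt0 ?exprn_gt0.
  have [u Au] := A0 _ r0'.
  exists u, (r ^+ 2 / 4) => // v Av.
  rewrite -ball_normE /= norm_ltE ?ltW//.
  apply: le_lt_trans (gap _ _) _.
  by move: Au Av; rewrite /A /=; lra.
have Fcvg : cvg F by exact: cauchy_cvg.
exists (lim F) => h; set w := lim F.
have near_w (r : R) : 0 < r -> exists2 u, A r u & rdot (w - u) (w - u) < r ^+ 2.
  move=> r0.
  have Fb : F (ball w r%:C%C) by apply: Fcvg; apply: nbhsx_ballx; rewrite ltcR.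
  have FA : F (A r) by exists r.
  have [u [Au]] := filter_ex (filterI FA Fb).
  by rewrite -ball_normE /= norm_ltE ?ltW// => ?; exists u.
apply/eqP; rewrite -subr_eq0 -sqrf_eq0 eq_le sqr_ge0 andbT.
set a := rdot h h; have a0 : 0 <= a by exact: rdot_ge0.
suff bound (r : R) : 0 < r -> r < 1 ->
    (rdot h w - l h) ^+ 2 <= 4 * (a + 1) * r.
  apply: contraT; rewrite -ltNge; set K := _ ^+ 2 => K0.
  suff : 0 < 0 :> R by rewrite ltxx.
  (* Chosen so that [0 < r < 1] and [8 (a + 1) r < K], which defeats the bound. *)
  pose r := K / (8 * (a + 1) + K).
  have D0 : 0 < 8 * (a + 1) + K by lra.
  have rE : r * (8 * (a + 1) + K) = K by rewrite /r mulfVK// gt_eqF.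
  have r0 : 0 < r by rewrite divr_gt0.
  have r1 : r < 1 by nra.
  by have := bound _ r0 r1; rewrite -/K; nra.
move=> r0 r1; have [u Au wu] := near_w r r0.
(* [u] minimizes [J] up to [r], so along the line [u + t h] the function [J] drops by at most [r];
   this is a quadratic inequality in [t]. *)
have : (rdot u h - l h) ^+ 2 <= r * (a + 1).
  apply: quadratic_ge_bound => // t.
  have := dJ (u + t%:C%C *: h); move: Au.
  rewrite /A /J /= lD lZ !rdotE (rdotC h u) -/a; nra.
have := sqr_rdot_le (w - u) h; rewrite rdotDl rdotNl (rdotC h w) -/a.
move: wu; set b := rdot (w - u) (w - u); set x := rdot u h; set y := rdot w h.
move=> bb h1 h2; set c := l h in h2 *.
have br : b * (a + 1) <= r * (a + 1) by apply: ler_wpM2r; nra.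
have := sqr_ge0 ((y - x) - (x - c)); nra.
Qed.

Lemma bounded_op_linear (S : H -> H) : bounded_op S ->
  exists S0 : {linear H -> H}, S = S0.
Proof.
case=> Slin _.
pose S0 := HB.pack_for {linear H -> H} S (GRing.isLinear.Build _ _ _ _ S Slin).
by exists S0.
Qed.

(** [reducing] constrains only maps already known to be adjoints, so one must be produced. Riesz
    represents the real part of [dot (S u) v] as a functional of [u]; complex linearity recovers the
    imaginary part. *)
Lemma adjoint_exists (S : H -> H) : bounded_op S ->
  exists S', is_adjoint dot S S'.
Proof.
move=> Sb; have [S0 S0E] := bounded_op_linear Sb; case: Sb => _ [c cS].
have {}cS u : rdot (S u) (S u) <= c ^+ 2 * rdot u u.
  rewrite -lecR rmorphM rmorphXn /= -!sqr_norm_rdot -exprMn.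
  by rewrite ler_pXn2r ?nnegrE// (le_trans _ (cS u)).
suff /choice[S' S'P] : forall v, exists w, forall u, dot (S u) v = dot u w.
  by exists S' => u v.
move=> v.
have [||t u|u|w wP] := @real_riesz (fun u => rdot (S u) v)
    (c ^+ 2 * (rdot v v + 1)).
- by apply: mulr_ge0; [exact: sqr_ge0|have := rdot_ge0 v; lra].
- by move=> a b; rewrite S0E linearD rdotDl.
- by rewrite S0E linearZ rdotZl.
- apply: le_trans (sqr_rdot_le _ _) _.
  rewrite mulrAC; apply: ler_wpM2r => //.
  by have := rdot_ge0 v; lra.
exists w => u; apply/eqP; rewrite eq_complex; apply/andP; split.
  by have := wP u; rewrite /rdot => ->.
(* Multiplying by ['i] turns the imaginary part into minus the real part. *)
have := wP ('i%C *: u); rewrite /rdot S0E linearZ !dotZl.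
case: (dot _ v) => a b; case: (dot u w) => a' b' /=.
by rewrite !mul0r !mul1r !sub0r => /oppr_inj ->.
Qed.

Lemma adjointC (S S' : H -> H) : is_adjoint dot S S' -> is_adjoint dot S' S.
Proof. by move=> SS' u v; rewrite dotC -SS' -dotC. Qed.

(** [S'] is a bare function, so this comes from [|S' 0|^2 = dot (S (S' 0)) 0]. *)
Lemma adjoint0 (S : {linear H -> H}) (S' : H -> H) : is_adjoint dot S S' -> S' 0 = 0.
Proof.
move=> SS'; apply/eqP; rewrite -normr_eq0 -sqrf_eq0 dotN -SS'.
by rewrite dot0r.
Qed.

Lemma closureP (A : set H) u : closure A u <->
  forall eps : R, 0 < eps -> exists2 v, A v & `|u - v| < eps%:C%C.
Proof.
split=> [Au eps eps0|Au B].
  have [|v [Av]] := Au (ball u eps%:C%C).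
    by apply: nbhsx_ballx; rewrite ltcR.
  by rewrite -ball_normE; exists v.
rewrite -nbhs_ballE => -[eps /= eps0 uB].
have epsE : eps = (complex.Re eps)%:C%C.
  by move: eps0; rewrite ltcE; case: (eps) => a b /= /andP[/eqP -> _].
move: eps0; rewrite epsE ltcR => /Au[v Av uv].
exists v; split => //; apply: uB.
by rewrite -ball_normE /= epsE.
Qed.

(** * Testing vectors and operators against an orthonormal basis *)

Section Basis.
Variables (X : Type) (e : X -> H) (eB : orthonormal_basis dot e).

Lemma basis_sub_closed (M : set H) : is_subspace M -> closed M ->
  (forall y, M (e y)) -> M = setT.
Proof.
move=> Msub Mcl Me; rewrite -subTset; case: eB => _ _ <-.
rewrite [X in _ `<=` X](closure_id M).1//.
by apply: closureS; apply: smallest_sub => // _ [y _ <-].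
Qed.

(** Some [g] in the span lies within distance less than [|w|] of [w], whereas [g] orthogonal to [w]
    forces [|w - g| >= |w|]. *)
Lemma basis_orthogonal w : (forall y, dot (e y) w = 0) -> w = 0.
Proof.
move=> ew.
have span_w : lin_span e `<=` [set g | dot g w = 0].
  apply: smallest_sub; last by move=> _ [y _ <-]; exact: ew.
  split=> [|a u v uw vw]; first exact: dot0l.
  by rewrite /= dotDl dotZl uw vw mulr0 addr0.
apply/eqP; apply: contraT => w0.
have q0 : 0 < rdot w w by rewrite -ltcR -sqr_norm_rdot exprn_gt0 ?normr_gt0.
have : closure (lin_span e) w by case: eB => _ _ ->.
move=> /closureP/(_ (Num.sqrt (rdot w w))); rewrite sqrtr_gt0 => /(_ q0)[g /span_w gw].
have gw0 : rdot g w = 0 by rewrite /rdot gw.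
rewrite norm_ltE ?sqrtr_ge0// sqr_sqrtr ?ltW// !rdotE (rdotC w g) gw0 => h.
suff : 0 < 0 :> R by rewrite ltxx.
by have := rdot_ge0 g; lra.
Qed.

(** Testing against the basis turns the hypothesis into [S' S S' = S'] everywhere. Then
    [p = S' (S u)] satisfies [rdot u p = |p|^2 = |S u|^2], and [|u - p|^2 >= 0] concludes. *)
Lemma partial_isometry_contracts (S : {linear H -> H}) (S' : H -> H) :
  is_adjoint dot S S' -> (forall y, S (S' (S (e y))) = S (e y)) ->
  forall u, `|S u| <= `|u|.
Proof.
move=> SS' SSS u; have S'S := adjointC SS'.
have S'SS' v : S' (S (S' v)) = S' v.
  apply/eqP; rewrite -subr_eq0; apply/eqP; apply: basis_orthogonal => y.
  by rewrite dotBr -SS' -S'S -SS' SSS SS' subrr.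
set p := S' (S u).
have pp : rdot p p = rdot (S u) (S u).
  by rewrite /rdot /p S'S SS' S'SS' -SS'.
have up : rdot u p = rdot (S u) (S u) by rewrite /rdot /p -SS'.
have := rdot_ge0 (u - p); rewrite !rdotE (rdotC p u) up pp => h.
rewrite -(@ler_pXn2r _ 2) ?nnegrE// !sqr_norm_rdot lecR; lra.
Qed.

End Basis.

Lemma projection_contracts v u : dot v v = 1 -> `|dot u v *: v| <= `|u|.
Proof.
move=> v1; rewrite -(@ler_pXn2r _ 2) ?nnegrE// !sqr_norm_rdot lecR.
set p := dot u v *: v.
have up : rdot u p = rdot p p.
  by rewrite /rdot /p !dotZr !dotZl v1 mulr1.
by have := rdot_ge0 (u - p); rewrite !rdotE (rdotC p u) up; lra.
Qed.

End RealInnerProduct.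

(** * Itineraries and the separating condition *)

Section Itineraries.
Variables (X : Type) (f : X -> X) (k : nat) (P : 'I_k -> set X).
Hypothesis fP : bounded_partition f P.

Lemma partition_inj i j y : P i y -> P j y -> i = j.
Proof. by case: fP => tP _ _ iy jy; apply: tP => //; exists y. Qed.

Lemma itinerary_exists x : exists c : nat -> 'I_k, forall j, P (c j) (iter j f x).
Proof.
suff /choice : forall j, exists i, P i (iter j f x).
  by case=> c cx; exists c.
move=> j; case: fP => _ PT _.
by have : setT (iter j f x) by []; rewrite -PT => -[i _ ?]; exists i.
Qed.

(** Each step of the merging is undone by injectivity on the common piece. *)
Lemma itinerary_inj (c : nat -> 'I_k) y z m :
  (forall j, P (c j) (iter j f y)) -> (forall j, P (c j) (iter j f z)) ->
  iter m f y = iter m f z -> y = z.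
Proof.
case: fP => _ _ inj cy cz; elim: m => //= m IH /inj yz.
by apply/IH/(yz (c m)); apply/mem_set.
Qed.

Lemma separating_itinerary_inj x y (c : nat -> 'I_k) : separating f P x ->
  orbit_equiv f x y ->
  (forall j, P (c j) (iter j f x)) -> (forall j, P (c j) (iter j f y)) -> y = x.
Proof.
move=> [[n0 n0_gt0 n0x] sep] [_ [[b _ <-] [a _ ab]]] cx cy.
have [n [n_gt0 nx n_min]] : exists n, min_period f x n.
  have ex : exists n, (0 < n)%N && `[< iter n f x = x >].
    by exists n0; rewrite n0_gt0; exact/asboolP.
  case: (ex_minnP ex) => n /andP[n_gt0 /asboolP nx] n_min.
  by exists n; split => // m m0 mx; apply: n_min; rewrite m0; exact/asboolP.
have mulx m : iter (m * n) f x = x.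
  by elim: m => // m IH; rewrite mulSn iterD IH.
have modx m : iter m f x = iter (m %% n) f x.
  by rewrite {1}(divn_eq m n) addnC iterD mulx.
pose t := map_tuple c (iota_tuple n 0).
have ap : aperiodic t.
  by apply: sep => // j; rewrite tnth_map (tnth_nth 0%N) /= nth_iota.
(* The phase: after [a * n] steps, a whole number of periods and at least [a], the point [y] sits at
   position [j] of the cycle of [x]. *)
pose j := ((b + (a * n - a)) %% n)%N.
have yj : iter (a * n) f y = iter j f x.
  have an : (a <= a * n)%N by rewrite leq_pmulr.
  by rewrite -modx addnC iterD -ab -iterD subnK.
have cper m : c (n + m)%N = c m.
  by apply: (@partition_inj _ _ (iter m f x)) => //; rewrite -{1}nx -iterD addnC.
have cperM q m : c (q * n + m)%N = c m.
  by elim: q => // q IH; rewrite mulSn -addnA cper.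
(* The point at position [j + m] of the cycle is also visited by [y] at time [a * n + m], whose
   label is [c m]. *)
have crot m : c (j + m)%N = c m.
  rewrite -[RHS](cperM a).
  apply: (@partition_inj _ _ (iter m f (iter j f x))); first by rewrite -iterD addnC.
  by rewrite -yj -iterD addnC.
have j_lt : (j < n)%N by rewrite ltn_mod.
have j0 : j = 0%N.
  apply/eqP; rewrite -leqn0 leqNgt; apply/negP => j_gt0.
  apply: (ap j); first by rewrite j_gt0.
  rewrite /= -map_rot /rot drop_iota take_iota map_cat add0n.
  rewrite (minn_idPl (ltnW j_lt)).
  (* By [n]-periodicity the block rotated to the back may be read just after position [n - 1], so
     the rotation lists [c] from [j] on. *)
  have -> : map c (iota 0 j) = map c (iota (j + (n - j)) j).
    rewrite subnKC ?(ltnW j_lt)// -{1}(addn0 n) iotaDl -map_comp.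
    by apply: eq_map => m /=; rewrite cper.
  rewrite -map_cat -iotaD subnK ?(ltnW j_lt)// -{1}(addn0 j) iotaDl -map_comp.
  by apply: eq_map => m /=; exact: crot.
apply: (@itinerary_inj c _ _ (a * n)%N) => //.
by rewrite yj j0 mulx.
Qed.

End Itineraries.

(** * Words of operators along an itinerary *)

Fixpoint word (V : Type) (k : nat) (T : 'I_k -> V -> V) (c : nat -> 'I_k) (m : nat)
    (u : V) : V :=
  if m is m'.+1 then T (c m') (word T c m' u) else u.

Section PartialShift.
Context {R : realType} {H : completeNormedModType R[i]}.
Variables (dot : {dot H for Num.conj}) (dotN : induces_norm dot).
Variables (X : Type) (e : X -> H) (eB : orthonormal_basis dot e) (f : X -> X).

Section OneShift.
Variables (D : set X) (S : {linear H -> H}) (S' : H -> H).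
Hypotheses (injD : set_inj D f) (SS' : is_adjoint dot S S').
Hypotheses (S_in : forall y, D y -> S (e y) = e (f y)).
Hypotheses (S_out : forall y, ~ D y -> S (e y) = 0).

(** Tested against each [e z]: injectivity on [D] keeps [S (e z)] orthogonal to [e (f y)] unless
    [z = y]. *)
Lemma shift_adjointE y : D y -> S' (e (f y)) = e y.
Proof.
move=> Dy; apply/eqP; rewrite -subr_eq0; apply/eqP.
apply: (basis_orthogonal dotN eB) => z; rewrite dotBr -SS'.
case: eB => e1 e0 _; have [->|zy] := EM (z = y).
  by rewrite S_in// !e1 subrr.
rewrite (e0 _ _ zy) subr0; have [Dz|Dz] := EM (D z); last first.
  by rewrite S_out// dot0l.
rewrite S_in// e0// => fzy; apply: zy.
by apply: injD => //; exact/mem_set.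
Qed.

Lemma shift_contracts u : `|S u| <= `|u|.
Proof.
apply: (partial_isometry_contracts dotN eB SS') => y.
have [Dy|Dy] := EM (D y); first by rewrite S_in// shift_adjointE// S_in.
by rewrite S_out// (adjoint0 dotN SS') linear0.
Qed.

End OneShift.

Variables (k : nat) (P : 'I_k -> set X) (T : 'I_k -> {linear H -> H}).
Hypotheses (T_in : forall i y, P i y -> T i (e y) = e (f y)).
Hypotheses (T_out : forall i y, ~ P i y -> T i (e y) = 0).
Variable (c : nat -> 'I_k).
Local Notation W := (word (fun i => T i : H -> H) c).

Lemma word_linear m a u v : W m (a *: u + v) = a *: W m u + W m v.
Proof. by elim: m => //= m IH; rewrite IH linearP. Qed.

Lemma word_contracts (T_le : forall i u, `|T i u| <= `|u|) m u : `|W m u| <= `|u|.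
Proof. by elim: m => //= m IH; exact: le_trans IH. Qed.

Lemma word_closed (N : set H) (TN : forall i u, N u -> N (T i u)) m u :
  N u -> N (W m u).
Proof. by move=> Nu; elim: m => //= m IH; exact: TN. Qed.

Lemma word_basis m y : W m (e y) = e (iter m f y) \/ W m (e y) = 0.
Proof.
elim: m => [|m [IH|IH]]; first by left.
  rewrite /= IH.
  have [Pm|Pm] := EM (P (c m) (iter m f y)); first by left; rewrite T_in.
  by right; rewrite T_out.
by right; rewrite /= IH linear0.
Qed.

Lemma word_follow y : (forall j, P (c j) (iter j f y)) ->
  forall m, W m (e y) = e (iter m f y).
Proof.
by move=> cy; elim=> // m IH; rewrite /= IH T_in.
Qed.

(** Before letter [j] the vector is [e (iter j f y)], which that letter kills, or already 0. *)
Lemma word_kill j y : ~ P (c j) (iter j f y) ->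
  forall m, (j < m)%N -> W m (e y) = 0.
Proof.
move=> cj; elim=> // m IH; rewrite ltnS leq_eqVlt => /predU1P[jm|/IH{}IH].
  rewrite /= -jm.
  by have [->|->] := word_basis j y; rewrite ?T_out ?linear0.
by rewrite /= IH linear0.
Qed.

(** On the span of the basis, [W (m * n)] equals the projection exactly for large [m]; density and
    contractivity extend this approximately to all [u]. *)
Lemma word_projection x n : (0 < n)%N -> iter n f x = x ->
  (forall i u, `|T i u| <= `|u|) ->
  (forall j, P (c j) (iter j f x)) ->
  (forall y, (forall j, P (c j) (iter j f y)) -> y = x) ->
  forall u (eps : R), 0 < eps ->
    exists m, `|W m u - dot u (e x) *: e x| < eps%:C%C.
Proof.
move=> n0 nx T_le cx cy u eps eps0; case: (eB) => e1 e0 cl.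
have span_x : lin_span e `<=`
    [set g | exists N, forall m, (N <= m)%N -> W (m * n) g = dot g (e x) *: e x].
  apply: smallest_sub => [|_ [y _ <-]] /=.
    split=> [|a g h [N1 gN] [N2 hN]].
      exists 0%N => m _; rewrite dot0l scale0r.
      (* [W] is not packaged as a linear map; the factor [-1] at zero vectors yields [W 0 = 0]. *)
      by have := word_linear (m * n) (-1) 0 0; rewrite scaler0 add0r scaleN1r addNr.
    exists (maxn N1 N2) => m; rewrite geq_max => /andP[m1 m2].
    by rewrite word_linear gN// hN// dotDl dotZl scalerDl scalerA.
  have [->|yx] := EM (y = x).
    exists 0%N => m _; rewrite word_follow// e1 scale1r; congr e.
    by elim: m => // m IH; rewrite mulSn iterD IH.
  have /existsNP[j jP] : ~ forall j, P (c j) (iter j f y) by move=> /cy.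
  exists j.+1 => m jm; rewrite e0// scale0r (word_kill jP)//.
  by apply: leq_trans jm _; rewrite leq_pmulr.
have : closure (lin_span e) u by rewrite cl.
move=> /closureP/(_ (eps / 2)); rewrite divr_gt0// => /(_ isT)[g /span_x[N gN] ug].
(* On [g] the error vanishes; on [r = u - g] both the word and the projection contribute at most
   [|r| < eps / 2]. *)
exists (N * n)%N; rewrite -[u](subrK g); move: ug; set r := u - g => ug.
rewrite -[r]scale1r word_linear !scale1r gN// dotDl scalerDl opprD addrACA subrr addr0.
apply: le_lt_trans (ler_normB _ _) _.
apply: (@le_lt_trans _ _ (`|r| + `|r|)).
  by apply: lerD; [exact: word_contracts|exact: projection_contracts].
have -> : eps%:C%C = (eps / 2)%:C%C + (eps / 2)%:C%C.
  by rewrite -rmorphD -splitr.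
exact: ltrD.
Qed.

End PartialShift.

Unset Implicit Arguments.

Theorem theorem5p2p4 (X : Type) (countX : countable [set: X])
  (infX : infinite_set [set: X]) (f : X -> X)
  (k : nat) (k_ge1 : (1 <= k)%N) (P : 'I_k -> set X)
  (fP : bounded_partition f P)
  (R : realType) (H : completeNormedModType R[i])
  (dot : {dot H for Num.conj}) (dotN : induces_norm dot)
  (e : X -> H) (eB : orthonormal_basis dot e)
  (T : 'I_k -> H -> H) (T_bounded : forall i, bounded_op (T i))
  (T_in : forall i x, P i x -> T i (e x) = e (f x))
  (T_out : forall i x, ~ P i x -> T i (e x) = 0)
  (x : X) (sep_x : separating f P x)
  (sim : forall y z : X, orbit_equiv f y z) :
  forall M : set H, reducing dot (Cstar dot (range T)) M ->
    M = [set 0] \/ M = setT.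
Proof.
move=> M [Msub Mcl MC].
have /choice[S SP] : forall i, exists S, is_adjoint dot (T i) S.
  by move=> i; exact: adjoint_exists.
have /choice[T0 T0E] : forall i, exists T0 : {linear H -> H}, T i = T0.
  by move=> i; exact: bounded_op_linear.
have [PT inj_f] : (forall y, exists i, P i y) /\ forall i, set_inj (P i) f.
  case: fP => _ PT inj_f; split=> // y.
  by have : setT y by []; rewrite -PT => -[i _ ?]; exists i.
have TC i : Cstar dot (range T) (T i) by move=> A [_]; apply; exists i.
have MT i u : M u -> M (T i u) by move=> Mu; apply: (MC _ (TC i)).1; exists u.
have MS i u : M u -> M (S i u).
  by move=> Mu; apply: ((MC _ (TC i)).2 _ (SP i)); exists u.
have SP0 i : is_adjoint dot (T0 i) (S i) by rewrite -T0E.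
have T0_in i y : P i y -> T0 i (e y) = e (f y) by rewrite -T0E; exact: T_in.
have T0_out i y : ~ P i y -> T0 i (e y) = 0 by rewrite -T0E; exact: T_out.
have Se i y : P i y -> S i (e (f y)) = e y.
  exact: (shift_adjointE dotN eB (inj_f i) (SP0 i) (T0_in i) (T0_out i)).
have T0_le i u : `|T0 i u| <= `|u|.
  exact: (shift_contracts dotN eB (inj_f i) (SP0 i) (T0_in i) (T0_out i)).
(* Move forward from [x] to the meeting point with the [T i], then back along the orbit of [y] with
   their adjoints. It serves both for [M] and for its orthogonal complement. *)
have spread (N : set H) : N (e x) -> (forall i u, N u -> N (T i u)) ->
    (forall i u, N u -> N (S i u)) -> forall y, N (e y).
  move=> Nx NT NS y; have [_ [[b _ <-] [a _ ab]]] := sim x y.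
  have Nb m : N (e (iter m f x)).
    elim: m => //= m IH; have [i Pi] := PT (iter m f x).
    by rewrite -(T_in i)//; exact: NT.
  have : N (e (iter a f y)) by rewrite ab.
  elim: (a) => //= m IH Nm; apply: IH; have [i Pi] := PT (iter m f y).
  by rewrite -(Se i)//; exact: NS.
have [c cx] := itinerary_exists fP x.
have [[n n0 nx] _] := sep_x.
have proj u : M u -> M (dot u (e x) *: e x).
  move=> Mu; rewrite ((closure_id M).1 Mcl); apply/closureP => eps eps0.
  have [m Wm] := word_projection dotN eB T0_in T0_out n0 nx T0_le cx
    (fun y => separating_itinerary_inj fP sep_x (sim x y) cx) u eps0.
  exists (word (fun i => T0 i : H -> H) c m u); last by rewrite distrC.
  by apply: word_closed => // i v; rewrite -T0E; exact: MT.
have [[u Mu ux]|Mx] := EM (exists2 u, M u & dot u (e x) != 0).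
  right; apply: (basis_sub_closed eB) => //; apply: spread => //.
  have := Msub.2 (dot u (e x))^-1 _ _ (proj _ Mu) Msub.1.
  by rewrite addr0 scalerA mulVf// scale1r.
left; apply/seteqP; split=> [u Mu|_ ->]; last exact: Msub.1.
apply: (basis_orthogonal dotN eB) => y.
(* The orthogonal complement of [M]; it is stable under [T i] because [M] is stable under [S i], and
   conversely. *)
pose N : set H := [set v | forall u, M u -> dot v u = 0].
apply: (spread N) => // {u Mu y}.
- by move=> u Mu; apply: dot0P; apply/eqP/negPn/negP => ux; apply: Mx; exists u.
- by move=> i v Nv u Mu; rewrite SP; apply/Nv/MS.
- by move=> i v Nv u Mu; rewrite (adjointC (SP i)); apply/Nv/MT.
Qed.
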